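(* Let $G$ be an ordered graph with edge set $E$, and let $\vec G$ be an orientation of $G$. Activity classes of orientations of $G$ partition the set of orientations of $G$: $$\{\text{orientations of }G\}=\biguplus_{\substack{\text{activity classes of orientations of }G\\ \text{(one }-_A\vec G\text{ chosen in each class)}}}\Bigl\{\text{the }2^{|O(-_A\vec G)|+|O^*(-_A\vec G)|}\text{ orientations obtained from }-_A\vec G\text{ by reorienting unions of parts of its active partition}\Bigr\}.$$
   Context: Graphs are finite, connected, and may have loops and multiple edges. An ordered graph has a linearly ordered edge set. $-_A\vec G$ is obtained from $\vec G$ by reversing (reorienting) the edges in $A\subseteq E$. Cycles and cocycles (inclusion-minimal non-empty edge cuts) are edge subsets. A cycle is directed if its edges are consistently oriented along it; a cocycle is directed if all its edges go from one side of the cut to the other. $\subset$ denotes strict inclusion. For an ordered digraph $\vec H$ on $E$, $O^*(\vec H)=\{a_1<\cdots<a_\iota\}$ is the set of smallest edges of directed cocycles and $O(\vec H)=\{a'_1<\cdots<a'_\varepsilon\}$ the set of smallest edges of directed cycles. The active filtration of $\vec H$ is $\emptyset=F'_\varepsilon\subset\cdots\subset F'_0=F_c=F_0\subset\cdots\subset F_\iota=E$, where $F_c$ is the union of all directed cycles, $F_k=E\setminus\bigcup\{D\text{ directed cocycle}:\min(D)\ge a_{k+1}\}$ for $0\le k\le\iota-1$, and $F'_k=\bigcup\{C\text{ directed cycle}:\min(C)\ge a'_{k+1}\}$ for $0\le k\le\varepsilon-1$. The active partition of $\vec H$ has parts $F_k\setminus F_{k-1}$ ($1\le k\le\iota$)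 and $F'_{k-1}\setminus F'_k$ ($1\le k\le\varepsilon$). The activity class of $\vec H$ is the set of all orientations obtained by reorienting any union of parts of the active partition of $\vec H$. *)

(* Defs.v *)
From mathcomp Require Import all_boot all_order.

Set Implicit Arguments.
Unset Strict Implicit.
Unset Printing Implicit Defensive.

(* Each edge has two ends, labelled by [bool]; a loop is an edge whose ends are
   attached to the same vertex. *)
Record ordered_graph (d : Order.disp_t) := OrderedGraph {
  vertex : finType;
  edge : finOrderType d;
  end_vertex : edge -> bool -> vertex
}.

Section OrderedGraphs.

Variables (d : Order.disp_t) (G : ordered_graph d).
Local Notation V := (vertex G).
Local Notation E := (edge G).

Definition adjacent : rel V := fun u v =>
  [exists e : E, exists b, (end_vertex e b == u) && (end_vertex e (~~ b) == v)].

Definition connected : Prop := forall u v : V, connect adjacent u v.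

(* An orientation selects the head of every edge among its two ends.  A loop
   thus has two distinct orientations, and G has exactly 2 ^ #|E| of them. *)
Definition orientation := {ffun E -> bool}.

Implicit Types (o : orientation) (A C D : {set E}) (X : {set V}).

Definition head o (e : E) : V := end_vertex e (o e).
Definition tail o (e : E) : V := end_vertex e (~~ o e).

Definition reorient o A : orientation := [ffun e => o e (+) (e \in A)].

(* The pair (e, b) stands for the edge e walked through towards its end b. *)
Definition step := (E * bool)%type.
Definition step_source (x : step) : V := end_vertex x.1 (~~ x.2).
Definition step_target (x : step) : V := end_vertex x.1 x.2.

(* s is a closed walk without repeated vertices that uses each edge of C
   exactly once, and no other edge. *)
Definition traverses (s : seq step) C : bool :=
  [&& perm_eq [seq x.1 | x <- s] (enum C),
      uniq [seq step_source x | x <- s] &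
      cycle (fun x y => step_target x == step_source y) s].

Definition is_cycle C : bool :=
  (C != set0) && [exists s : #|C|.-tuple step, traverses s C].

Definition directed_cycle o C : bool :=
  is_cycle C &&
  [exists s : #|C|.-tuple step,
     traverses s C && all (fun x : step => o x.1 == x.2) s].

Definition cut X : {set E} :=
  [set e | (end_vertex e false \in X) != (end_vertex e true \in X)].

Definition is_cocycle D : bool :=
  minset (fun D' : {set E} => (D' != set0) && [exists X, D' == cut X]) D.

Definition directed_cocycle o D : bool :=
  is_cocycle D &&
  [exists X, (D == cut X) &&
     [forall e in D, (tail o e \in X) && (head o e \notin X)]].

Definition is_min (e : E) A : bool :=
  (e \in A) && [forall f in A, (e <= f)%O].

Definition min_ge A (a : E) : bool := [exists e, is_min e A && (a <= e)%O].

(* O(o) and O^*(o) *)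
Definition active o : {set E} :=
  [set e | [exists C, directed_cycle o C && is_min e C]].

Definition dual_active o : {set E} :=
  [set e | [exists D, directed_cocycle o D && is_min e D]].

Definition increasing A : seq E := sort <=%O (enum A).

(* F_k, for k <= #|dual_active o|.  As [onth] counts from 0, the edge a below
   is a_(k+1); there is none when k = #|dual_active o|.  The two filtrations meet:
   F_0 = F'_0 is the union F_c of all directed cycles, because every edge lies
   in a directed cycle or in a directed cocycle, and never in both. *)
Definition acyclic_filtration o (k : nat) : {set E} :=
  if onth (increasing (dual_active o)) k is Some a
  then ~: \bigcup_(D | directed_cocycle o D && min_ge D a) D
  else [set: E].

(* F'_k, for k <= #|active o|. *)
Definition cyclic_filtration o (k : nat) : {set E} :=
  if onth (increasing (active o)) k is Some a
  then \bigcup_(C | directed_cycle o C && min_ge C a) C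
  else set0.

Definition active_partition o : {set {set E}} :=
  [set acyclic_filtration o k.+1 :\: acyclic_filtration o k
     | k : 'I_#|dual_active o|]
  :|: [set cyclic_filtration o k :\: cyclic_filtration o k.+1
     | k : 'I_#|active o|].

Definition activity_class o : {set orientation} :=
  [set reorient o (cover P) | P in powerset (active_partition o)].

Definition activity_classes : {set {set orientation}} :=
  [set activity_class o | o : orientation].

End OrderedGraphs.

Arguments activity_classes {d} G.

(* Main.v *)
From mathcomp Require Import all_boot all_order zify.
Require Import Defs.

Set Implicit Arguments.
Unset Strict Implicit.
Unset Printing Implicit Defensive.

Import Order.TTheory.

(** The active filtration of an orientation [o] can be read off one increasing
    chain of relations on vertices, [arc o 0], [arc o 1], ..., [arc o (2 * #|E|)].
    Starting from the empty relation, the arcs of the edges are added in their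
    direction, from the largest edge down to the smallest; then the reversed
    arcs are added, from the smallest edge up to the largest.  Deleting the
    small edges keeps only the cycles with a large minimum, while making the
    small edges traversable both ways (that is, contracting them) keeps only
    the cocycles with a large minimum, so this single chain treats cycles and
    cocycles together.

    Let [stage o j] consist of the edges that are present at step [j] and whose
    head then reaches their tail, and let [level o e] be the first [j] for
    which [e] is in [stage o j].  In the first half of the chain an edge is in
    a stage iff it lies in a directed cycle made of edges already present
    ([stage_cycleP]).  In the second half it is outside a stage iff it lies in
    a directed cocycle that avoids the edges already made two-way
    ([stage_cocycleP]).  Hence the sets of the active filtration are stages,
    the parts of the active partition are the fibres of the level function
    ([active_partitionE]), and each fibre contains exactly one edge of O or of
    O^* ([level_representative], [card_active_partition]).

    The heart of the proof is that reorienting a union [S] of fibres does not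
    change the level function ([level_reorient]).  If some edge left a stage,
    take such an edge f of smallest level: the set reached from its new head
    defines a cut that is directed after reorientation, and in [o] the edge f
    lies on a closed walk, which crosses this cut backwards along an edge of
    the same level; but two edges of one level are both reversed or both kept,
    so they cannot cross a directed cut in opposite directions.  If some edge
    entered a stage, take such an edge f of largest level: the number of
    vertices reachable in [o] just below that level is a potential that is
    monotone along a closed walk of the reorientation through f, and strictly
    monotone at f, which is impossible.

    Consequently, lying in the activity class of [o] means differing from [o]
    on a set that is a union of fibres of [level o], and this is an equivalence
    relation, since the level function is constant on a class and unions of
    fibres are stable under symmetric difference ([activity_class_eq]).  The
    size of a class is the number of unions of parts, that is, two to the
    number of parts. *)

(** * Reachability along a relation *)

Section Connectivity.

Variables (T : finType) (r : rel T).

Lemma connect_exits (X : {set T}) x y :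
    connect r x y -> x \in X -> y \notin X ->
  exists u v, [/\ r u v, u \in X & v \notin X].
Proof.
case/connectP=> p; elim: p x => [|z p IHp] x /=; first by move=> _ -> ->.
case/andP=> rxz pth_p def_y xX yX.
have [zX|zX] := boolP (z \in X); first exact: IHp pth_p def_y zX yX.
by exists x, z.
Qed.

Lemma connect_homo (T' : Type) (leT : rel T') (h : T -> T') x y :
    reflexive leT -> transitive leT ->
  {homo h : u v / r u v >-> leT u v} -> connect r x y -> leT (h x) (h y).
Proof.
move=> leTxx leT_trans h_homo /connectP[p].
elim: p x => [|z p IHp] x /=; first by move=> _ ->.
by case/andP=> /h_homo/leT_trans le_xz pth_p /(IHp _ pth_p)/le_xz.
Qed.

(** The arcs that lie on a closed walk. *)
Definition strong : rel T := fun u v => r u v && connect r v u.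

(** The return path from [y] to [x] closes any path from [x] to [y] into a
    walk. *)
Lemma connect_strong x y : connect r x y -> connect r y x -> connect strong x y.
Proof.
case/connectP=> p; elim: p x => [|z p IHp] x /=; first by move=> _ -> _.
case/andP=> rxz pth_p def_y yx.
have zy : connect r z y by apply/connectP; exists p.
apply: connect_trans (IHp _ pth_p def_y (connect_trans yx (connect1 rxz))).
by apply: connect1; rewrite /strong rxz (connect_trans zy).
Qed.

End Connectivity.

(** * The chain of stages and the level of an edge *)

Section ActivityClasses.

Variables (d : Order.disp_t) (G : ordered_graph d).
Local Notation V := (vertex G).
Local Notation E := (edge G).
Local Notation n := #|E|.

Implicit Types (o : orientation G) (S C D : {set E}) (X Y Z : {set V}) (a b e f g m : E).

(** Ranks turn the thresholds on edges into the indices of the chain: the arc of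
    [e] is added at step [#|E| - rank e], and its reversal at step
    [#|E| + rank e + 1]. *)
Definition rank e : nat := #|[set f : E | (f < e)%O]|.

Lemma rank_lt_card e : rank e < n.
Proof.
rewrite -cardsT; apply: proper_card; rewrite properT.
by apply/eqP=> /setP/(_ e); rewrite !inE ltxx.
Qed.

Lemma leq_rank : {mono rank : e f / (e <= f)%O >-> e <= f}.
Proof.
apply: le_mono => e f lt_ef; apply: proper_card; apply/properP; split.
  by apply/subsetP=> g; rewrite !inE => /lt_trans->.
by exists e; rewrite !inE ?ltxx.
Qed.

Lemma rank_inj : injective rank.
Proof. exact: inc_inj leq_rank. Qed.

Definition fwd (j : nat) : {set E} := [set e | n <= rank e + j].
Definition bwd (j : nat) : {set E} := [set e | n + rank e < j].

Lemma sub_fwd i j : i <= j -> fwd i \subset fwd j.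
Proof. by move=> ?; apply/subsetP=> e; rewrite !inE; lia. Qed.

Lemma sub_bwd i j : i <= j -> bwd i \subset bwd j.
Proof. by move=> ?; apply/subsetP=> e; rewrite !inE; lia. Qed.

Lemma bwd_sub_fwd j : bwd j \subset fwd j.
Proof. by apply/subsetP=> e; rewrite !inE; lia. Qed.

Definition arc o j : rel V := fun u v =>
  [exists e, (e \in fwd j) && (tail o e == u) && (head o e == v)
          || (e \in bwd j) && (head o e == u) && (tail o e == v)].

Lemma arcP o j u v :
  reflect (exists e, [/\ e \in fwd j, tail o e = u & head o e = v]
                  \/ [/\ e \in bwd j, head o e = u & tail o e = v])
          (arc o j u v).
Proof.
apply: (iffP existsP) => [[e] | [e e_uv]]; last first.
  by exists e; case: e_uv => [] [-> -> ->]; rewrite !eqxx ?orbT.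
case/orP=> /andP[/andP[ej /eqP<-] /eqP<-]; exists e; by [left | right].
Qed.

Lemma fwd_arc o j e : e \in fwd j -> arc o j (tail o e) (head o e).
Proof. by move=> ej; apply/arcP; exists e; left. Qed.

Lemma bwd_arc o j e : e \in bwd j -> arc o j (head o e) (tail o e).
Proof. by move=> ej; apply/arcP; exists e; right. Qed.

Definition reach o j u : {set V} := [set v | connect (arc o j) u v].

Lemma sub_reach o i j u : i <= j -> reach o i u \subset reach o j u.
Proof.
move=> ij; apply/subsetP=> v; rewrite !inE.
apply: connect_sub => x y /arcP[e [] [ei <- <-]]; apply: connect1.
  exact/fwd_arc/(subsetP (sub_fwd ij)).
exact/bwd_arc/(subsetP (sub_bwd ij)).
Qed.

(** Two-way edges are always in the stage, and the stage is the set of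
    all edges inside the strong components of [arc o j]. *)
Definition stage o j : {set E} :=
  [set e in fwd j | connect (arc o j) (head o e) (tail o e)].

Lemma in_stage o j e :
  (e \in stage o j) = (e \in fwd j) && connect (arc o j) (head o e) (tail o e).
Proof. exact: in_set. Qed.

Lemma sub_stage o i j : i <= j -> stage o i \subset stage o j.
Proof.
move=> ij; apply/subsetP=> e; rewrite !in_stage => /andP[ei].
rewrite (subsetP (sub_fwd ij)) //=.
by have /subsetP/(_ (tail o e)) := sub_reach o (head o e) ij; rewrite !inE.
Qed.

Lemma bwd_sub_stage o j : bwd j \subset stage o j.
Proof.
apply/subsetP=> e ej; rewrite in_stage (subsetP (bwd_sub_fwd j)) //.
exact/connect1/bwd_arc.
Qed.

Lemma stage_exhausts o e : exists j, e \in stage o j.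
Proof.
exists (n + n); apply: (subsetP (bwd_sub_stage _ _)).
by have := rank_lt_card e; rewrite inE; lia.
Qed.

Definition level o e : nat := ex_minn (stage_exhausts o e).

Lemma mem_stage o j e : (e \in stage o j) = (level o e <= j).
Proof.
rewrite /level; case: ex_minnP => i ei min_i.
by apply/idP/idP=> [/min_i // | /(sub_stage o)/subsetP->].
Qed.

Lemma level_gt0 o e : 0 < level o e.
Proof.
rewrite ltnNge -mem_stage in_stage negb_and inE; have := rank_lt_card e.
by rewrite addn0 -ltnNge => ->.
Qed.

(** The rest of the closed walk leads from the head of the edge back to its
    tail if the edge is traversed forwards; if it is traversed backwards, then
    it is two-way and belongs to the stage by itself. *)
Lemma strong_arc o j u v : strong (arc o j) u v ->
  exists2 e, e \in stage o j &
    tail o e = u /\ head o e = v \/ [/\ e \in bwd j, head o e = u & tail o e = v].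
Proof.
case/andP=> /arcP[e [] [ej eu ev]] vu; exists e; try by [left|right].
  by rewrite in_stage ej eu ev.
exact: (subsetP (bwd_sub_stage o j)).
Qed.

Lemma stage_strong o j e : e \in stage o j ->
  connect (strong (arc o j)) (head o e) (tail o e).
Proof.
rewrite in_stage => /andP[e_j et]; apply: connect_strong => //.
exact/connect1/fwd_arc.
Qed.

Lemma head_reorient o S e :
  head (reorient o S) e = if e \in S then tail o e else head o e.
Proof.
by rewrite /head /tail ffunE; case: (e \in S); rewrite ?addbT ?addbF.
Qed.

Lemma tail_reorient o S e :
  tail (reorient o S) e = if e \in S then head o e else tail o e.
Proof.
by rewrite /head /tail ffunE; case: (e \in S); rewrite ?addbT ?addbF ?negbK.
Qed.

(** * Invariance of the levels under reorientation *)

(** The unions of fibres of the level function. *)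
Definition saturated o S : Prop :=
  forall e f, level o e = level o f -> (e \in S) = (f \in S).

(** A directed cut of the reorientation cannot be crossed in both directions by
    edges of one level; the extremal choice of the edge [f] below forces the
    closed walk through [f] to return across the cut along such an edge. *)
Lemma stage_reorient_sub o S j :
  saturated o S -> stage o j \subset stage (reorient o S) j.
Proof.
move=> satS; apply/subsetP=> e0 e0j; apply/negPn/negP=> e0j'.
set o' := reorient o S in e0j' *.
pose P e := (e \in stage o j) && (e \notin stage o' j).
have Pe0: P e0 by rewrite /P e0j.
(* Smallest level: the walk through [f] lives in [stage o (level o f)], so any
   edge of it that also left the stage has the level of [f]. *)
case: (arg_minnP (level o) Pe0) => {e0 e0j e0j' Pe0} f /andP[fj fj'] min_f.
have f_fwd: f \in fwd j by move: fj; rewrite in_stage => /andP[].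
pose X := reach o' j (head o' f).
have hX: head o' f \in X by rewrite inE connect0.
have tX: tail o' f \notin X by move: fj'; rewrite in_stage f_fwd inE.
have X_fwd g: g \in fwd j -> tail o' g \in X -> head o' g \in X.
  by move=> gj; rewrite !inE => /connect_trans-> //; apply/connect1/fwd_arc.
have X_bwd g: g \in bwd j -> (tail o' g \in X) = (head o' g \in X).
  move=> gj; apply/idP/idP; first exact: X_fwd (subsetP (bwd_sub_fwd j) g gj).
  by rewrite !inE => /connect_trans-> //; apply/connect1/bwd_arc.
have X_bwd_o g: g \in bwd j -> (tail o g \in X) = (head o g \in X).
  by move/X_bwd; rewrite head_reorient tail_reorient; case: ifP.
have lev_f: level o f <= j by rewrite -mem_stage.
have /stage_strong f_strong : f \in stage o (level o f) by rewrite mem_stage.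
(* Whether [S] reverses [f] decides from which side of the cut the walk starts. *)
have main (Y : {set V}) : (Y = X /\ f \notin S) \/ (Y = ~: X /\ f \in S) -> False.
  move=> defY.
  have [hY tY] : head o f \in Y /\ tail o f \notin Y.
    move: hX tX; rewrite head_reorient tail_reorient.
    by case: defY => [] [-> fS]; rewrite ?(negPf fS) ?fS // !inE => hX ->; rewrite negbK.
  have [u [v [/strong_arc[g glev uv] uY vY]]] := connect_exits f_strong hY tY.
  have gj: g \in stage o j by apply: (subsetP (sub_stage o lev_f)).
  have g_fwd: g \in fwd j by move: gj; rewrite in_stage => /andP[].
  case: uv => [[ug vg] | [gb ug vg]]; last first.
    have := X_bwd_o g (subsetP (sub_bwd lev_f) g gb); move: uY vY.
    rewrite ug vg; case: defY => [] [-> _]; rewrite ?in_setC;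
      by case: (u \in X); case: (v \in X).
  have gj': g \notin stage o' j.
    apply/negP; rewrite in_stage g_fwd /= => hg.
    have : (tail o' g \in X) = (head o' g \in X).
      apply/idP/idP; first exact: X_fwd.
      by rewrite !inE => /connect_trans->.
    rewrite head_reorient tail_reorient ug vg; move: uY vY.
    case: defY => [] [-> _]; rewrite ?in_setC; case: ifP => _;
      by case: (u \in X); case: (v \in X).
  have gf: level o g = level o f.
    by apply/eqP; rewrite eqn_leq -mem_stage glev; apply: min_f; rewrite /P gj.
  have:= X_fwd g g_fwd; rewrite head_reorient tail_reorient (satS _ _ gf) ug vg.
  move: uY vY; case: defY => [] [-> fS]; rewrite ?fS ?(negPf fS) ?in_setC;
    by case: (u \in X); case: (v \in X) => // _ _ /(_ isT).
have [fS|fS] := boolP (f \in S).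
  by apply: (main (~: X)); right.
by apply: (main X); left.
Qed.

(** Weakly decreasing along the arcs of [arc o j], and constant exactly on its
    strong components. *)
Definition potential o j v : nat := #|reach o j v|.

Lemma potential_head o j e : e \in fwd j ->
  potential o j (head o e) <= potential o j (tail o e) ?= iff (e \in stage o j).
Proof.
move=> ej.
have sub: reach o j (head o e) \subset reach o j (tail o e).
  apply/subsetP=> w; rewrite !inE; apply: connect_trans.
  exact/connect1/fwd_arc.
have := subset_leqif_card sub; rewrite in_stage ej; congr (_ <= _ ?= iff _).
apply/subsetP/idP=> [/(_ (tail o e)) | et w]; rewrite !inE.
  by rewrite connect0 => ->.
exact: connect_trans.
Qed.

(** At the step just before the level of [f], the edges of the closed walk
    through [f] either leave the potential unchanged or have the level of [f],
    in which case they all move it in the same direction as [f] does. *)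
Lemma stage_reorient_sup o S j :
  saturated o S -> stage (reorient o S) j \subset stage o j.
Proof.
move=> satS; apply/subsetP=> e0 e0j'; apply/negPn/negP=> e0j.
set o' := reorient o S in e0j' *.
pose P e := (e \in stage o' j) && (e \notin stage o j).
have Pe0: P e0 by rewrite /P e0j'.
(* Largest level: an edge of the walk that is still outside the stage of [o]
   at step [i] below must have the level of [f]. *)
case: (arg_maxnP (level o) Pe0) => {e0 e0j e0j' Pe0} f /andP[fj' fj] max_f.
pose i := (level o f).-1.
have lev_f: level o f = i.+1 by rewrite /i prednK // level_gt0.
have ij: j <= i by move: fj; rewrite mem_stage lev_f -ltnNge.
have f_fwd: f \in fwd i.
  by apply: (subsetP (sub_fwd ij)); move: fj'; rewrite inE => /andP[].
have step u v : strong (arc o' j) u v ->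
    if f \in S then potential o i u <= potential o i v
    else potential o i v <= potential o i u.
  case/strong_arc=> g gj' guv.
  have g_fwd: g \in fwd i.
    by apply: (subsetP (sub_fwd ij)); move: gj'; rewrite inE => /andP[].
  have pg := potential_head o g_fwd.
  have [gi|gi] := boolP (g \in stage o i).
    have: potential o i u = potential o i v.
      have pgE: potential o i (head o g) = potential o i (tail o g).
        by apply/eqP; rewrite pg.
      by case: guv => [[<- <-] | [_ <- <-]];
         rewrite head_reorient tail_reorient; case: ifP.
    by move->; case: ifP.
  case: guv => [[<- <-] | [gb _ _]]; last first.
    by case/negP: gi; apply: (subsetP (bwd_sub_stage o i)); apply: (subsetP (sub_bwd ij)).
  have gj: g \notin stage o j.
    by apply: contra gi; apply: (subsetP (sub_stage o ij)).
  have gf: level o g = level o f.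
    apply/eqP; rewrite eqn_leq {2}lev_f ltnNge -(mem_stage o i) gi andbT.
    by apply: max_f; rewrite /P gj'.
  rewrite head_reorient tail_reorient (satS _ _ gf).
  by case: (f \in S); case: pg.
have pf: potential o i (tail o f) <= potential o i (head o f).
  move/stage_strong: fj'; rewrite head_reorient tail_reorient.
  case: ifP step => _ step; first exact: (connect_homo leqnn leq_trans step).
  exact: (connect_homo (leT := geq) leqnn (rev_trans leq_trans) step).
have := potential_head o f_fwd; rewrite mem_stage lev_f ltnn => h.
by have := ltn_leqif h; rewrite ltnNge pf.
Qed.

Theorem level_reorient o S : saturated o S -> level (reorient o S) =1 level o.
Proof.
move=> satS e; have eq_stage j : (e \in stage (reorient o S) j) = (e \in stage o j).
  apply/idP/idP; apply/subsetP; first exact: stage_reorient_sup.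
  exact: stage_reorient_sub.
apply/eqP; rewrite eqn_leq -mem_stage eq_stage mem_stage leqnn /=.
by rewrite -(mem_stage o) -eq_stage mem_stage.
Qed.

(** * Directed cycles, directed cocycles and stages *)

Definition follows o : rel E := fun e f => head o e == tail o f.

(** The direction of each step being imposed by [o], a directed traversal is
    determined by its sequence of edges. *)
Lemma directed_cycleP o C :
  reflect (exists es, [/\ es != [::], C =i es, uniq (map (tail o) es)
                        & cycle (follows o) es])
          (directed_cycle o C).
Proof.
apply: (iffP andP) => [[/andP[C0 _] /existsP[s]] | [es [es0 defC Ues es_cyc]]].
  case/andP=> /and3P[/perm_mem s_C Us s_cyc] /allP s_o.
  have src: {in s, tail o \o fst =1 @step_source _ G}.
    by move=> x /s_o/eqP; rewrite /= /tail /step_source => ->.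
  have tgt: {in s, head o \o fst =1 @step_target _ G}.
    by move=> x /s_o/eqP; rewrite /= /head /step_target => ->.
  exists [seq x.1 | x <- s]; split.
  - apply: contraNneq C0 => s0; apply/eqP/setP=> e.
    by rewrite inE -mem_enum -s_C s0.
  - by move=> e; rewrite s_C mem_enum.
  - by rewrite -map_comp (iffLR (eq_in_map _ _ _) src).
  rewrite cycle_map; apply: (sub_in_cycle (P := [in s])) s_cyc; last exact/allP.
  move=> x y xs ys.
  by rewrite /= /follows -[head o _]/((head o \o fst) x) tgt // -src.
have uniq_es := map_uniq Ues.
have size_es: size [seq (e, o e) | e <- es] == #|C|.
  by rewrite size_map (eq_card defC); apply/eqP/esym/card_uniqP.
have es_C: traverses [seq (e, o e) | e <- es] C.
  rewrite /traverses -!map_comp map_id_in // cycle_map; apply/and3P; split=> //.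
  by apply: uniq_perm; rewrite ?enum_uniq // => e; rewrite mem_enum defC.
have C0: C != set0.
  case: es es0 defC {Ues es_cyc uniq_es size_es es_C} => // e es _ defC.
  by apply/set0Pn; exists e; rewrite defC mem_head.
split; first by apply/andP; split=> //; apply/existsP; exists (Tuple size_es).
apply/existsP; exists (Tuple size_es); rewrite es_C.
by apply/allP=> _ /mapP[e _ ->] /=.
Qed.

(** The list [es] leaves out both extreme edges [e] and [f], so that for
    [f := e] the list [e :: es] is a cycle for [follows]. *)
Lemma path_edges o j e p f : bwd j = set0 ->
    path (arc o j) (head o e) p -> last (head o e) p = tail o f ->
  exists es, [/\ {subset es <= fwd j}, path (follows o) e (rcons es f)
               & map (tail o) (rcons es f) = head o e :: p].
Proof.
move=> b0; elim: p e => [|z p IHp] e /= => [_ eq_ef | /andP[/arcP[g g_ez]]].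
  by exists [::]; rewrite /follows /= eq_ef eqxx.
case: g_ez => [[gj g_e <-] | [gb]]; last by rewrite b0 inE in gb.
move=> /IHp{}IHp /IHp[es [es_j es_path es_p]]; exists (g :: es); split=> /=.
- by move=> h; rewrite inE => /predU1P[-> // | /es_j].
- by rewrite {1}/follows g_e eqxx.
by rewrite g_e es_p.
Qed.

Lemma follows_connect o j e es f : {subset es <= fwd j} ->
  path (follows o) e (rcons es f) -> connect (arc o j) (head o e) (tail o f).
Proof.
elim: es e => [|g es IHes] e es_j /= /andP[/eqP->]; first by rewrite connect0.
move/IHes=> IH; apply: connect_trans (IH _) => [|h hes].
  by apply/connect1/fwd_arc/es_j/mem_head.
by apply: es_j; rewrite inE hes orbT.
Qed.

(** A shortest path from the head of [e] to its tail closes into a directed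
    cycle through [e], and conversely a directed cycle is such a path. *)
Lemma stage_cycleP o j e : j <= n ->
  reflect (exists C, [/\ directed_cycle o C, e \in C & C \subset fwd j])
          (e \in stage o j).
Proof.
move=> jn; have b0: bwd j = set0 by apply/setP=> f; rewrite !inE; lia.
rewrite in_stage; apply: (iffP andP) => [[ej] | [C [dirC eC /subsetP Cj]]].
  case/connectP=> p0 /shortenP[p p_path Up _] /esym p_last.
  have [es [es_j es_path es_p]] := path_edges b0 p_path p_last.
  exists [set f in e :: es]; split; last 1 first.
  - by apply/subsetP=> f; rewrite in_set inE => /predU1P[-> // | /es_j].
  - apply/directed_cycleP; exists (e :: es); split=> // [f|]; first by rewrite inE.
    by move: Up; rewrite -es_p map_rcons rcons_uniq.
  by rewrite !inE eqxx.
split; first exact: Cj.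
case/directed_cycleP: dirC => es [_ defC _ es_cyc].
have [i es' es_rot] : rot_to_spec es e by apply: rot_to; rewrite -defC.
apply: (@follows_connect _ _ _ es'); last by rewrite -(rot_cycle i) es_rot in es_cyc.
by move=> f fes'; apply: Cj; rewrite defC -(mem_rot i) es_rot inE fes' orbT.
Qed.

Lemma in_cut o X e : (e \in cut X) = ((tail o e \in X) != (head o e \in X)).
Proof. by rewrite inE /tail /head; case: (o e) => //=; rewrite eq_sym. Qed.

Definition linked D : rel V := fun u v =>
  [exists e, exists b, [&& e \notin D, end_vertex e b == u & end_vertex e (~~ b) == v]].

(** The connected component of [u] once the edges of [D] are deleted. *)
Definition component D u : {set V} := [set v | connect (linked D) u v].

Lemma linked_cut D X u v : cut X \subset D ->
  connect (linked D) u v -> (u \in X) = (v \in X).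
Proof.
move=> XD; apply: closed_connect => {}u {}v /existsP[e /existsP[b /and3P[eD]]].
move=> /eqP<- /eqP<-; have := contra (subsetP XD e) eD.
by rewrite inE negbK => /eqP; case: b.
Qed.

Lemma cut_component D u : cut (component D u) \subset D.
Proof.
apply/subsetP=> e; rewrite inE; apply: contraNT => eD; apply/eqP.
apply/idP/idP; rewrite !inE => /connect_trans-> //; apply/connect1/existsP; exists e.
  by apply/existsP; exists false; rewrite eD !eqxx.
by apply/existsP; exists true; rewrite eD !eqxx.
Qed.

(** Two passes to components suffice.  Deleting the cut, let Y be the component
    of the head of [e]; deleting then the cut of Y, let Z be the component of
    the tail of [e].  The cut of Z separates the connected sets Z and Y, so no
    smaller non-empty cut is contained in it; being contained in the cut of X,
    it keeps the direction of the latter. *)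
Lemma directed_cut_cocycle o X e : e \in cut X ->
    {in cut X, forall f, tail o f \in X} ->
  exists D, [/\ directed_cocycle o D, e \in D & D \subset cut X].
Proof.
move=> eX tX.
have hX f : f \in cut X -> head o f \notin X.
  move=> fX; have := tX f fX; move: fX; rewrite (in_cut o) => /[swap] ->.
  by case: (_ \in X).
pose Y := component (cut X) (head o e).
have YX: cut Y \subset cut X by apply: cut_component.
have XY v : v \in Y -> v \notin X.
  by rewrite inE => /(linked_cut (subxx _)) <-; apply: hX.
have tY f : f \in cut X -> tail o f \notin Y.
  by move=> fX; apply/negP=> /XY; rewrite tX.
have hY f : f \in cut Y -> head o f \in Y.
  move=> fY; have := fY; rewrite (in_cut o) (negPf (tY f _)) ?(subsetP YX) //.
  by case: (_ \in Y).
have eY: e \in cut Y by rewrite (in_cut o) (negPf (tY e eX)) inE connect0.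
pose Z := component (cut Y) (tail o e).
have ZY: cut Z \subset cut Y by apply: cut_component.
have hZ f : f \in cut Y -> head o f \notin Z.
  move=> fY; apply/negP; rewrite inE => /(linked_cut (subxx _)).
  by rewrite (negPf (tY e eX)) hY.
have tZ f : f \in cut Z -> tail o f \in Z.
  move=> fZ; have := fZ; rewrite (in_cut o) (negPf (hZ f _)) ?(subsetP ZY) //.
  by case: (_ \in Z).
have eZ: e \in cut Z by rewrite (in_cut o) (negPf (hZ e eY)) inE connect0.
exists (cut Z); split=> //; last exact: subset_trans YX.
apply/andP; split; last first.
  apply/existsP; exists Z; rewrite eqxx; apply/forall_inP=> f fZ.
  by rewrite tZ // hZ // (subsetP ZY).
apply/minsetP; split=> [|D' /andP[D'0 /existsP[T /eqP def_D']] TZ].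
  by apply/andP; split; [apply/set0Pn; exists e | apply/existsP; exists Z].
rewrite {D'}def_D' in D'0 TZ *; have /set0Pn[g gT] := D'0.
apply/eqP; rewrite eqEsubset TZ; apply/subsetP=> f fZ.
have tT h : h \in cut Z -> (tail o h \in T) = (tail o e \in T).
  move/tZ; rewrite inE => eh; apply/esym.
  exact: linked_cut (subset_trans TZ ZY) eh.
have hT h : h \in cut Z -> (head o h \in T) = (head o e \in T).
  move/(subsetP ZY)/hY; rewrite inE => eh; apply/esym.
  exact: linked_cut (subset_trans TZ (subset_trans ZY YX)) eh.
have gZ := subsetP TZ g gT.
by move: gT; rewrite !(in_cut o) !tT ?hT.
Qed.

(** The set reached from the head of [e] defines a directed cut through [e] that
    no two-way edge crosses; conversely, no arc leads back across a directed
    cocycle. *)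
Lemma stage_cocycleP o j e : n <= j ->
  reflect (exists D, [/\ directed_cocycle o D, e \in D & [disjoint D & bwd j]])
          (e \notin stage o j).
Proof.
move=> nj; have fT f : f \in fwd j by rewrite inE; lia.
rewrite in_stage fT /=; apply: (iffP idP) => [not_ht | [D [dirD eD Dj]]].
  pose X := ~: reach o j (head o e).
  have X_fwd f : tail o f \notin X -> head o f \notin X.
    by rewrite !inE !negbK => /connect_trans->; last exact/connect1/fwd_arc.
  have tX: {in cut X, forall f, tail o f \in X}.
    move=> f; rewrite (in_cut o); have := X_fwd f.
    by case: (tail o f \in X) => // /(_ isT)/negPf->.
  have eX: e \in cut X by rewrite (in_cut o) !inE not_ht connect0.
  have [D [dirD eD DX]] := directed_cut_cocycle eX tX.
  exists D; split=> //; apply/pred0P=> f /=; apply/negP=> /andP[/(subsetP DX) fX fb].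
  have tfX := tX f fX; move: fX; rewrite (in_cut o) tfX => hfX.
  move: tfX hfX; rewrite !inE => /negP tf; rewrite negbK => hf; apply: tf.
  exact: connect_trans hf (connect1 (bwd_arc o fb)).
case/andP: dirD => _ /existsP[X /andP[/eqP defD /forall_inP dirD]].
have /andP[tX hX] := dirD e eD.
apply/negP=> /(connect_exits (X := ~: X)); rewrite !inE hX tX.
case=> // u [v [/arcP[f]]]; rewrite !inE negbK.
case=> [] [f_j <- <-] uX vX.
  have/dirD/andP[] : f \in D by rewrite defD (in_cut o) vX (negPf uX).
  by rewrite (negPf uX).
have/(disjointFr Dj) : f \in D by rewrite defD (in_cut o) vX (negPf uX).
by rewrite inE f_j.
Qed.

(** * The active partition as the set of fibres of the level function *)

Lemma ex_min C e : e \in C -> exists m, is_min m C.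
Proof.
move=> eC; have := arg_minnP rank (eC : (fun f => f \in C) e).
case=> m mC min_m; exists m; rewrite /is_min mC; apply/forall_inP=> f fC.
by rewrite -leq_rank min_m.
Qed.

Lemma min_geP C a e : e \in C -> reflect {in C, forall f, (a <= f)%O} (min_ge C a).
Proof.
move=> eC; apply: (iffP existsP) => [[m] | aC].
  by case/andP=> /andP[_ /forall_inP mC] am f /mC; apply: le_trans.
have [m m_min] := ex_min eC; exists m; rewrite m_min /=; apply: aC.
by case/andP: m_min.
Qed.

Lemma mem_fwd_rank a f : (f \in fwd (n - rank a)) = (a <= f)%O.
Proof. by rewrite inE -leq_rank; have := rank_lt_card a; lia. Qed.

Lemma mem_bwd_rank a f : (f \in bwd (n + rank a)) = (f < a)%O.
Proof. by rewrite inE ltn_add2l ltnNge leq_rank ltNge. Qed.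

Lemma leq_level_cycle o a e :
  reflect (exists C, [/\ directed_cycle o C, e \in C & min_ge C a])
          (level o e <= n - rank a).
Proof.
rewrite -mem_stage; apply: (iffP (stage_cycleP _ _ (leq_subr _ _))).
  case=> C [dirC eC /subsetP Ca]; exists C; split=> //; apply/(min_geP _ eC) => f.
  by move/Ca; rewrite mem_fwd_rank.
case=> C [dirC eC /(min_geP _ eC) aC]; exists C; split=> //; apply/subsetP=> f fC.
by rewrite mem_fwd_rank aC.
Qed.

Lemma gtn_level_cocycle o a e :
  reflect (exists D, [/\ directed_cocycle o D, e \in D & min_ge D a])
          (n + rank a < level o e).
Proof.
rewrite ltnNge -mem_stage; apply: (iffP (stage_cocycleP _ _ (leq_addr _ _))).
  case=> D [dirD eD Da]; exists D; split=> //; apply/(min_geP _ eD) => f fD.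
  by have := disjointFr Da fD; rewrite mem_bwd_rank leNgt => ->.
case=> D [dirD eD /(min_geP _ eD) aD]; exists D; split=> //.
apply/pred0P=> f /=; apply/negP=> /andP[/aD af]; rewrite mem_bwd_rank.
by rewrite ltNge af.
Qed.

(** The edge [a] is absent from the chain before step [#|E| - rank a], so this
    is the least level that [a] can have. *)
Lemma active_level o a : (a \in active o) = (level o a == n - rank a).
Proof.
have -> : (level o a == n - rank a) = (level o a <= n - rank a).
  rewrite eqn_leq andb_idr // => _; have := leqnn (level o a).
  by rewrite -mem_stage in_stage inE => /andP[]; lia.
rewrite inE; apply/existsP/leq_level_cycle => [[C /andP[dirC a_min]] | [C [dirC aC]]].
  exists C; split=> //; first by case/andP: a_min.
  by apply/existsP; exists a; rewrite a_min lexx.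
by move/(min_geP _ aC)=> ?; exists C; rewrite dirC /is_min aC; apply/forall_inP.
Qed.

(** The edge [a] is two-way from step [#|E| + rank a + 1] on, so this is the
    largest level that [a] can have. *)
Lemma dual_active_level o a : (a \in dual_active o) = (level o a == (n + rank a).+1).
Proof.
have -> : (level o a == (n + rank a).+1) = (n + rank a < level o a).
  rewrite eqn_leq andb_idl // => _; rewrite -mem_stage.
  by apply: (subsetP (bwd_sub_stage o _)); rewrite inE.
rewrite inE; apply/existsP/gtn_level_cocycle => [[D /andP[dirD a_min]] | [D [dirD aD]]].
  exists D; split=> //; first by case/andP: a_min.
  by apply/existsP; exists a; rewrite a_min lexx.
by move/(min_geP _ aD)=> ?; exists D; rewrite dirD /is_min aD; apply/forall_inP.
Qed.

(** The representative is the minimum of a directed cycle, or of a directed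
    cocycle, that witnesses the level of [e]: all edges of this witness are at
    least that minimum, which therefore bounds the level of [e] on the other
    side as well. *)
Lemma level_representative o e :
  exists2 m, level o m = level o e & (m \in active o) || (m \in dual_active o).
Proof.
have min_level (C : {set E}) m : e \in C -> is_min m C ->
    m \in C /\ min_ge C m.
  move=> eC /[dup] m_min /andP[mC _]; split=> //.
  by apply/existsP; exists m; rewrite m_min lexx.
have [le_n | gt_n] := leqP (level o e) n.
  have/(stage_cycleP _ _ le_n)[C [dirC eC Cj]] : e \in stage o (level o e).
    by rewrite mem_stage.
  have [m m_min] := ex_min eC; have [mC Cm] := min_level C m eC m_min.
  have m_act : m \in active o by rewrite inE; apply/existsP; exists C; rewrite dirC.
  exists m; rewrite ?m_act //; apply/eqP; rewrite eqn_leq -{1}mem_stage.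
  apply/andP; split; first by apply/(stage_cycleP _ _ le_n); exists C.
  move: m_act; rewrite active_level => /eqP->.
  by apply/leq_level_cycle; exists C.
have gt_n' : n <= (level o e).-1 by rewrite -ltnS prednK // (leq_trans _ gt_n).
have ltP x : (level o e <= level o x) = (x \notin stage o (level o e).-1).
  by rewrite mem_stage -ltnNge prednK // (leq_trans _ gt_n).
have/(stage_cocycleP _ _ gt_n')[D [dirD eD Dj]] : e \notin stage o (level o e).-1.
  by rewrite -ltP.
have [m m_min] := ex_min eD; have [mD Dm] := min_level D m eD m_min.
have m_dual : m \in dual_active o.
  by rewrite inE; apply/existsP; exists D; rewrite dirD.
exists m; rewrite ?m_dual ?orbT //; apply/eqP; rewrite eqn_leq ltP andbC.
apply/andP; split; first by apply/(stage_cocycleP _ _ gt_n'); exists D.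
move: m_dual; rewrite dual_active_level => /eqP->.
by apply/gtn_level_cocycle; exists D.
Qed.

(** There is no next entry after the last one, and every edge then passes. *)
Definition next_exceeds (s : seq E) k x : bool :=
  if onth s k.+1 is Some b then (x < b)%O else true.

Lemma next_exceedsE (A : {set E}) k a x :
    onth (increasing A) k = Some a -> x \in A ->
  next_exceeds (increasing A) k x = (x <= a)%O.
Proof.
rewrite /next_exceeds => ka xA.
have s_sorted : sorted <%O (increasing A) by rewrite sort_lt_sorted enum_uniq.
have /onthP[i ix] : x \in increasing A by rewrite mem_sort mem_enum.
have size_lt j y : onth (increasing A) j = Some y -> j < size (increasing A).
  by rewrite -onthTE => ->.
have mono_nth j y l z :
    onth (increasing A) j = Some y -> onth (increasing A) l = Some z ->
    ((y <= z)%O = (j <= l)) * ((y < z)%O = (j < l)).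
  move=> jy lz; have nth_j := odflt_onth a (increasing A) j.
  have nth_l := odflt_onth a (increasing A) l; rewrite jy lz /= in nth_j nth_l.
  rewrite nth_j nth_l lt_sorted_leq_nth ?lt_sorted_ltn_nth //;
    by rewrite inE ?(size_lt _ _ jy) ?(size_lt _ _ lz).
rewrite (mono_nth _ _ _ _ ix ka).
case kb: (onth _ k.+1) => [b|]; first by rewrite (mono_nth _ _ _ _ ix kb) ltnS.
have := size_lt _ _ ix; have := onthTE (increasing A) k.+1; rewrite kb /=.
lia.
Qed.

Lemma cyclic_filtrationE o k e :
  (e \in cyclic_filtration o k) =
  if onth (increasing (active o)) k is Some a then level o e <= n - rank a else false.
Proof.
rewrite /cyclic_filtration; case: onth => [a|]; last exact: in_set0.
apply/bigcupP/leq_level_cycle=> [[C /andP[dirC Ca] eC] | [C [dirC eC Ca]]].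
  by exists C.
by exists C; rewrite ?dirC.
Qed.

Lemma acyclic_filtrationE o k e :
  (e \in acyclic_filtration o k) =
  if onth (increasing (dual_active o)) k is Some a then level o e <= n + rank a else true.
Proof.
rewrite /acyclic_filtration; case: onth => [a|]; last exact: in_setT.
rewrite in_setC leqNgt; congr negb.
apply/bigcupP/gtn_level_cocycle=> [[D /andP[dirD Da] eD] | [D [dirD eD Da]]].
  by exists D.
by exists D; rewrite ?dirD.
Qed.

Definition level_class o a : {set E} := [set e | level o e == level o a].

(** A level in the first half of the chain is the level of some active edge m,
    and a <= m < b for consecutive active edges a and b leaves only m = a. *)
Lemma cyclic_partE o k a : onth (increasing (active o)) k = Some a ->
  cyclic_filtration o k :\: cyclic_filtration o k.+1 = level_class o a.
Proof.
move=> ka; apply/setP=> e; rewrite inE !cyclic_filtrationE ka inE.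
have a_act : a \in active o.
  by rewrite -mem_enum -(mem_sort <=%O); apply/onthP; exists k.
have [m <- /orP[m_act | m_dual]] := level_representative o e.
  have := next_exceedsE ka m_act; rewrite /next_exceeds.
  move: a_act m_act; rewrite !active_level => /eqP-> /eqP->.
  have := rank_lt_card m; have := rank_lt_card a.
  case: onth => [b|]; rewrite -!leq_rank ?(ltNge m b) -?leq_rank; last by lia.
  by have := rank_lt_card b; lia.
move: a_act m_dual; rewrite active_level dual_active_level => /eqP-> /eqP->.
by case: onth => [b|]; lia.
Qed.

Lemma acyclic_partE o k a : onth (increasing (dual_active o)) k = Some a ->
  acyclic_filtration o k.+1 :\: acyclic_filtration o k = level_class o a.
Proof.
move=> ka; apply/setP=> e; rewrite inE !acyclic_filtrationE ka inE.
have a_act : a \in dual_active o.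
  by rewrite -mem_enum -(mem_sort <=%O); apply/onthP; exists k.
have [m <- /orP[m_act | m_dual]] := level_representative o e; last first.
  have := next_exceedsE ka m_dual; rewrite /next_exceeds.
  move: a_act m_dual; rewrite !dual_active_level => /eqP-> /eqP->.
  case: onth => [b|]; rewrite -!leq_rank ?(ltNge m b) -?leq_rank; lia.
move: a_act m_act; rewrite active_level dual_active_level => /eqP-> /eqP->.
by case: onth => [b|]; lia.
Qed.

Lemma onth_increasing (A : {set E}) (F : nat -> {set E}) (H : E -> {set E}) :
  (forall k a, onth (increasing A) k = Some a -> F k = H a) ->
  [set F k | k : 'I_#|A|] = [set H a | a in A].
Proof.
move=> FH; have size_A : size (increasing A) = #|A| by rewrite size_sort cardE.
apply/setP=> P; apply/imsetP/imsetP=> [[k _ ->] | [a aA ->]].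
  case ka: (onth (increasing A) k) => [a|]; last first.
    by have := onthTE (increasing A) k; rewrite ka size_A ltn_ord.
  exists a; last exact: FH.
  by rewrite -mem_enum -(mem_sort <=%O); apply/onthP; exists k.
have /onthP[k ka] : a \in increasing A by rewrite mem_sort mem_enum.
have kA : k < #|A| by rewrite -size_A -onthTE ka.
by exists (Ordinal kA); rewrite //= (FH _ _ ka).
Qed.

Lemma active_partitionE o :
  active_partition o = [set level_class o a | a in active o :|: dual_active o].
Proof.
rewrite imsetU setUC /active_partition; congr (_ :|: _).
  exact: onth_increasing (@acyclic_partE o).
exact: onth_increasing (@cyclic_partE o).
Qed.

Lemma active_partitionP o : partition (active_partition o) [set: E].
Proof.
suff -> : active_partition o = preim_partition (level o) setT.
  exact: preim_partitionP.
rewrite active_partitionE; apply/setP=> P; apply/imsetP/imsetP=> [[a _ ->]|[e _ ->]].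
  by exists a => //; apply/setP=> f; rewrite !inE eq_sym.
have [m lev_m m_act] := level_representative o e; exists m; first by rewrite inE.
by apply/setP=> f; rewrite !inE lev_m eq_sym.
Qed.

Lemma card_active_partition o :
  #|active_partition o| = #|active o| + #|dual_active o|.
Proof.
rewrite active_partitionE card_in_imset => [|a b].
  rewrite cardsU; suff -> : active o :&: dual_active o = set0 by rewrite cards0 subn0.
  apply/setP=> a; rewrite in_setI active_level dual_active_level inE; lia.
rewrite !in_setU !active_level !dual_active_level => aA bA /setP/(_ a).
rewrite !inE eqxx => /esym/eqP ab; apply: rank_inj.
by have := rank_lt_card a; have := rank_lt_card b; lia.
Qed.

(** * Activity classes *)

(** A point of a block of [Q] lies in some block of [R]; both blocks are the only
    block of [P] through that point. *)
Lemma cover_inj (T : finType) (P Q R : {set {set T}}) :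
    trivIset P -> set0 \notin P -> Q \subset P -> R \subset P ->
  cover Q = cover R -> Q = R.
Proof.
move=> tiP P0; suff sub (Q' R' : {set {set T}}) :
    Q' \subset P -> R' \subset P -> cover Q' = cover R' -> Q' \subset R'.
  by move=> QP RP QR; apply/eqP; rewrite eqEsubset (sub Q R) // (sub R Q).
move=> /subsetP QP /subsetP RP QR; apply/subsetP=> B BQ.
have /set0Pn[x xB] : B != set0 by apply: contraNneq P0 => <-; apply: QP.
have /bigcupP[B' B'R xB'] : x \in cover R' by rewrite -QR; apply/bigcupP; exists B.
by rewrite -(def_pblock tiP (QP B BQ) xB) (def_pblock tiP (RP B' B'R) xB').
Qed.

Lemma cover_saturated o S :
  reflect (saturated o S) (S \in [set cover P | P in powerset (active_partition o)]).
Proof.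
have sameP e f B :
    B \in active_partition o -> level o e = level o f -> (e \in B) = (f \in B).
  by rewrite active_partitionE => /imsetP[a _ ->]; rewrite !inE => ->.
apply: (iffP imsetP) => [[P + ->] e f ef | satS].
  rewrite inE => /subsetP sub; apply/bigcupP/bigcupP=> [] [B BP eB]; exists B => //.
    by rewrite -(sameP e f B (sub _ BP) ef).
  by rewrite (sameP e f B (sub _ BP) ef).
exists [set B in active_partition o | B \subset S].
  by rewrite inE; apply/subsetP=> B; rewrite inE => /andP[].
apply/setP=> e; apply/idP/bigcupP=> [eS | [B]]; last first.
  by rewrite inE => /andP[_ /subsetP]; apply.
have [/eqP covP _ _] := and3P (active_partitionP o).
have /bigcupP[B BP eB] : e \in cover (active_partition o) by rewrite covP.
exists B => //; rewrite inE BP; apply/subsetP=> f.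
move: BP eB; rewrite active_partitionE => /imsetP[a _ ->].
rewrite !inE => /eqP ea /eqP fa.
by rewrite -(satS e) // ea fa.
Qed.

Definition differing o1 o2 : {set E} := [set e | o1 e != o2 e].

Lemma reorient_differing o1 o2 : reorient o1 (differing o1 o2) = o2.
Proof. by apply/ffunP=> e; rewrite ffunE inE; case: (o1 e) (o2 e) => [] []. Qed.

Lemma reorient_inj o : injective (reorient o).
Proof.
move=> S S' /ffunP eqS; apply/setP=> e; have := eqS e; rewrite !ffunE.
exact: addbI.
Qed.

Lemma mem_activity_class o S :
  reflect (saturated o S) (reorient o S \in activity_class o).
Proof.
apply: (iffP imsetP) => [[P PA /reorient_inj->] | /cover_saturated/imsetP[P PA ->]].
  by apply/cover_saturated/imsetP; exists P.
by exists P.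
Qed.

Lemma activity_class_refl o : o \in activity_class o.
Proof.
have {1}-> : o = reorient o set0 by apply/ffunP=> e; rewrite ffunE inE addbF.
apply/mem_activity_class => e f _; by rewrite !inE.
Qed.

(** Levels being the same for [o1] and [o2], both classes are described by the
    same saturated sets, and [differing o2 o3] is the symmetric difference of
    [differing o1 o3] with a saturated set. *)
Lemma activity_class_eq o1 o2 :
  o2 \in activity_class o1 -> activity_class o2 = activity_class o1.
Proof.
rewrite -(reorient_differing o1 o2).
move: (differing o1 o2) => S /mem_activity_class satS.
have lev := level_reorient satS; apply/setP=> o3.
rewrite -[in LHS](reorient_differing (reorient o1 S) o3).
rewrite -[in RHS](reorient_differing o1 o3).
have same e f : (e \in S) = (f \in S) ->
    ((e \in differing (reorient o1 S) o3) = (f \in differing (reorient o1 S) o3))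
    <-> ((e \in differing o1 o3) = (f \in differing o1 o3)).
  rewrite !inE !ffunE => ->.
  by case: (_ \in S) (o1 e) (o1 f) (o3 e) (o3 f) => [] [] [] [] [].
apply/mem_activity_class/mem_activity_class=> sat e f ef.
  by apply/(same _ _ (satS _ _ ef))/sat; rewrite !lev.
by move: ef; rewrite !lev => ef; apply/(same _ _ (satS _ _ ef))/sat.
Qed.

Lemma card_activity_class o :
  #|activity_class o| = 2 ^ (#|active o| + #|dual_active o|).
Proof.
rewrite card_in_imset => [|P Q]; first by rewrite card_powerset card_active_partition.
rewrite !powersetE => PA QA /reorient_inj; have [_ tiA A0] := and3P (active_partitionP o).
exact: cover_inj tiA A0 PA QA.
Qed.

Lemma activity_classesP : partition (activity_classes G) [set: orientation G].
Proof.
suff -> : activity_classes G =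
    equivalence_partition (fun o1 o2 => o2 \in activity_class o1) setT.
  apply/equivalence_partitionP => o1 o2 o3 _ _ _.
  by split; [exact: activity_class_refl | move/activity_class_eq->].
apply/setP=> K; apply/imsetP/imsetP=> [[o _ ->] | [o _ ->]]; exists o => //;
  by apply/setP=> o'; rewrite !inE.
Qed.

End ActivityClasses.

Theorem proposition3p18 (d : Order.disp_t) (G : ordered_graph d)
    (connG : connected G) (vG : orientation G) :
  partition (activity_classes G) [set: orientation G] /\
  forall A : {set orientation G} -> {set edge G},
    {in activity_classes G, forall K, reorient vG (A K) \in K} ->
    [/\ [set: orientation G] =
          \bigcup_(K in activity_classes G) activity_class (reorient vG (A K)),
        {in activity_classes G &, forall K L, K != L ->
          [disjoint activity_class (reorient vG (A K))
                  & activity_class (reorient vG (A L))]} &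
        {in activity_classes G, forall K,
          #|activity_class (reorient vG (A K))|
          = 2 ^ (#|active (reorient vG (A K))|
                 + #|dual_active (reorient vG (A K))|)}].
Proof.
split=> [|A repA]; first exact: activity_classesP.
have [/eqP cov_classes /trivIsetP ti_classes _] := and3P (activity_classesP G).
have classA : {in activity_classes G, forall K, activity_class (reorient vG (A K)) = K}.
  move=> K GK; have := repA K GK; case/imsetP: GK => o _ {2 4}->.
  exact: activity_class_eq.
split=> [|K L GK GL KL|K GK]; last exact: card_activity_class.
  by rewrite -cov_classes /cover; apply: eq_bigr => K /classA.
by rewrite !classA // ti_classes.
Qed.
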